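(* Let $(W,S)$ be a Coxeter system with $S$ finite and $\theta$ an involutive automorphism of $(W,S)$. Let $u\le v$ be elements of $\iota(\theta)$. If $u\star s=us$ for some $s\in D_R(v)$, then the order complex of the open interval $(u,v)=\{x\in\iota(\theta)\mid u<x<v\}$ in $\mathrm{Br}(\iota(\theta))$ is collapsible.
   Context: An automorphism of $(W,S)$ is a group automorphism of $W$ mapping $S$ onto $S$; involutive means $\theta^2=\mathrm{id}$. Twisted identities: $\iota(\theta)=\{\theta(w^{-1})w\mid w\in W\}$. For $w\in W$, $s\in S$: $w\star s=ws$ if $\theta(s)ws=w$, else $w\star s=\theta(s)ws$. $D_R(w)=\{s\in S\mid \ell(ws)<\ell(w)\}$, $\ell$ the Coxeter length. Bruhat order: $u\le v$ iff for every reduced expression $s_1\cdots s_k$ of $v$ there are $i_1<\cdots<i_m$ with $u=s_{i_1}\cdots s_{i_m}$; $\mathrm{Br}(\iota(\theta))$ is its restriction to $\iota(\theta)$. The order complex of a finite poset is the simplicial complex of its chains. *)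

(* Defs.v *)
From HB Require Import structures.
From mathcomp Require Import all_boot all_fingroup finmap.
From mathcomp Require Import boolp classical_sets.

Set Implicit Arguments.
Unset Strict Implicit.
Unset Printing Implicit Defensive.

Local Open Scope group_scope.
Local Open Scope classical_set_scope.

Section Coxeter.
Variables (W : groupType) (S : {fset W}).
Implicit Types (u v w s t x : W) (r : seq W).

Definition wprod r : W := \prod_(s <- r) s.

(* The value 0 encodes m s t = oo, that is, no relation between s and t. *)
Definition coxeter_matrix (m : W -> W -> nat) : Prop :=
  {in S & S, forall s t, m s t = m t s /\ (m s t == 1%N) = (s == t)}.

(* The congruence on words over S generated by (s t)^(m s t) ~ 1. The case
   s = t gives s s ~ 1, so formal inverses of the generators are not needed. *)
Inductive coxeter_equiv (m : W -> W -> nat) : seq W -> seq W -> Prop :=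
| CoxeterRel r1 r2 s t : s \in S -> t \in S ->
    coxeter_equiv m (r1 ++ flatten (nseq (m s t) [:: s; t]) ++ r2) (r1 ++ r2)
| CoxeterRefl r : coxeter_equiv m r r
| CoxeterSym r1 r2 : coxeter_equiv m r1 r2 -> coxeter_equiv m r2 r1
| CoxeterTrans r1 r2 r3 :
    coxeter_equiv m r1 r2 -> coxeter_equiv m r2 r3 -> coxeter_equiv m r1 r3.

Definition word r : Prop := {in r, forall s, s \in S}.

(* W has the presentation < S | (s t)^(m s t) = 1, s, t in S, m s t <> oo >. *)
Definition coxeter_system : Prop :=
  (forall w, exists2 r, word r & w = wprod r) /\
  exists2 m, coxeter_matrix m &
    forall r1 r2, word r1 -> word r2 ->
      (wprod r1 = wprod r2 <-> coxeter_equiv m r1 r2).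

Definition coxeter_automorphism (theta : W -> W) : Prop :=
  [/\ {morph theta : x y / x * y}, bijective theta &
      [fset theta s | s in S]%fset = S].

Definition has_expression_of_size w (n : nat) : Prop :=
  exists r, [/\ word r, w = wprod r & size r = n].

(* The default value 0 is irrelevant when S generates W as a monoid. *)
Definition clength w : nat :=
  xget 0%N [set n | has_expression_of_size w n /\
                    forall k, has_expression_of_size w k -> (n <= k)%N].

Definition right_descents w : set W :=
  [set s | s \in S /\ (clength (w * s) < clength w)%N].

Definition reduced_expression w r : Prop :=
  [/\ word r, w = wprod r & size r = clength w].

Definition bruhat u v : Prop :=
  forall r, reduced_expression v r -> exists2 r', subseq r' r & u = wprod r'.

Definition bruhat_lt u v : Prop := bruhat u v /\ u <> v.

Definition twisted_identities (theta : W -> W) : set W :=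
  [set theta w^-1 * w | w in [set: W]].

Definition star (theta : W -> W) w s : W :=
  if theta s * w * s == w then w * s else theta s * w * s.

Definition Br_interval (theta : W -> W) u v : set W :=
  [set x | [/\ twisted_identities theta x, bruhat_lt u x & bruhat_lt x v]].

End Coxeter.

Section Complexes.
Variable T : choiceType.

(* Simplicial complexes are given by their sets of nonempty faces. *)
Definition order_complex (le : T -> T -> Prop) (A : set T) : set {fset T} :=
  [set F | [/\ F != fset0, {in F, forall x, A x} &
               {in F &, forall x y, le x y \/ le y x}]].

Definition elementary_collapse (K L : set {fset T}) : Prop :=
  exists sigma tau : {fset T},
    [/\ K sigma, K tau, (sigma `<` tau)%fset & #|` tau| = #|` sigma|.+1] /\
    (forall rho, K rho -> (sigma `<=` rho)%fset -> rho = sigma \/ rho = tau) /\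
    L = K `\` [set sigma; tau].

Inductive collapses : set {fset T} -> set {fset T} -> Prop :=
| CollapsesRefl K : collapses K K
| CollapsesStep K L M :
    elementary_collapse K L -> collapses L M -> collapses K M.

Definition collapsible (K : set {fset T}) : Prop :=
  exists x : T, collapses K [set [fset x]%fset].

End Complexes.

(* Main.v *)
(** Counting occurrences of t among the left reflections of a word, modulo 2,
    gives a function of the represented element (the relations contribute each
    reflection an even number of times). This cocycle yields the exchange
    condition, and the map [down s], multiplying by s when this shortens, is
    decreasing and monotone for the Bruhat order. Composing the left version for
    theta(s) with the right version for s gives a closure operator on twisted
    identities. The condition u * s = us makes u a fixed point which is the
    image of no other twisted identity, so the operator acts on the open
    interval (u, v), and the image of v is the maximum of its image there. A
    finite poset with such an operator is dismantled to a point by removing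
    points whose links are cones. *)

Require Import Defs.
From mathcomp Require Import all_boot all_fingroup finmap.
From mathcomp Require Import boolp classical_sets.

Set Implicit Arguments.
Unset Strict Implicit.
Unset Printing Implicit Defensive.

(** * Collapses of order complexes of finite posets *)

Section CollapsingPosets.
Local Open Scope fset_scope.
Variable T : choiceType.
Implicit Types (K L M : set {fset T}) (A F : {fset T}) (x a : T).

Lemma collapses_trans K L M : collapses K L -> collapses L M -> collapses K M.
Proof. by elim=> {K L} // K L N KL _ IH /IH; apply: CollapsesStep. Qed.

(* Matching F with a |` F for the faces F containing x and not a, and removing
   the pairs by decreasing cardinality, makes F a free face at each stage. *)
Lemma collapses_star_cone K X x a : x != a ->
    (forall F, K F -> F `<=` X) ->
    (forall F, K F -> x \in F -> K (a |` F) /\ K (F `\ a)) ->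
  collapses K [set F | K F /\ x \notin F]%classic.
Proof.
move=> xa; have [n] := ubnP #|` [fset F in fpowerset X | `[<K F>]]|.
elim: n K => // n IH K cardK KX Kcone.
have [[F0 [KF0 xF0]]|noF] := pselect (exists F, K F /\ x \in F); last first.
  suff <- : K = [set F | K F /\ x \notin F]%classic by apply: CollapsesRefl.
  apply/seteqP; split=> F /= => [KF|[]//]; split=> //.
  by apply/negP => xF; apply: noF; exists F.
pose good F := [/\ K F, x \in F & a \notin F].
(* Deleting [a] from any face through [x] gives a good face, and cardinalities are bounded by that
   of [X], so a largest good face exists. *)
have exk : exists k, `[<exists2 F, good F & #|` F| = k>].
  exists #|` F0 `\ a|; apply/asboolP; exists (F0 `\ a) => //.
  by have [_ KD] := Kcone _ KF0 xF0; split=> //; rewrite !inE ?eqxx ?xa.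
have bndk k : `[<exists2 F, good F & #|` F| = k>] -> k <= #|` X|.
  by move=> /asboolP[F [KF _ _] <-]; apply/fsubset_leq_card/KX.
case: (ex_maxnP exk bndk) => k /asboolP[F [KF xF aF] <-{k}] Fmax.
have [KaF _] := Kcone F KF xF.
have FaF : F != a |` F.
  by apply/eqP => FE; move: aF; rewrite FE !inE eqxx.
apply: (@CollapsesStep _ _ (K `\` [set F; (a |` F)%fset])%classic).
  exists F, (a |` F); split; last split => //.
    by split=> //; rewrite ?fproperEneq ?FaF ?fsubsetUr// cardfsU1 aF.
  move=> G KG FG; have xG := fsubsetP FG _ xF.
  have [_ KGa] := Kcone G KG xG.
  (* Removing [a] from [G] leaves a good face containing [F]; maximality makes it equal to [F],
     which leaves two choices for [G]. *)
  have FGa : F `<=` G `\ a.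
    by apply/fsubsetP=> y yF; rewrite !inE (fsubsetP FG)// andbT;
      apply: contraNneq aF => <-.
  have GaE : F = G `\ a.
    apply/eqP; rewrite eqEfcard FGa Fmax//; apply/asboolP.
    by exists (G `\ a) => //; split=> //; rewrite !inE ?eqxx ?xa.
  have [aG|aG] := boolP (a \in G).
    by right; rewrite GaE fsetD1K.
  by left; rewrite GaE mem_fsetD1.
rewrite (_ : [set F | _]%classic =
    [set G | (K `\` [set F; (a |` F)%fset]) G /\ x \notin G]%classic);
  last first.
  apply/seteqP; split=> G /= [KG xG]; last by case: KG.
  split=> //; split=> // -[] GE; move: xG; rewrite GE ?xF//.
  by rewrite !inE xF orbT.
apply: IH => [|G []/KX//|G [KG nG] xG].
  rewrite -ltnS; apply: leq_trans cardK; rewrite ltnS.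
  apply: fproper_ltn_card; rewrite fproperE; apply/andP; split.
    apply/fsubsetP => G; rewrite !inE/= => /andP[-> /asboolP[KG _]].
    exact/asboolP.
  apply/fsubsetPn; exists F; rewrite !inE/= fpowersetE.
    by rewrite KX//=; apply/asboolP.
  by apply/negP => /andP[_ /asboolP[_]]; apply; left.
(* The removed pair is closed under adding and deleting [a], so neither operation leads into it from
   a remaining face. *)
have [KaG KGa] := Kcone G KG xG.
split; split=> // -[] GE; apply: nG.
- by move: aF; rewrite -GE !inE eqxx.
- have [aG|aG] := boolP (a \in G).
    by right; rewrite -GE; apply/fsetP=> y; rewrite !inE; case: eqVneq => // ->.
  by left; rewrite -(fsetU1K aG) GE fsetU1K.
- by have [aG|aG] := boolP (a \in G); [right; rewrite -GE fsetD1K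
    | left; rewrite -GE mem_fsetD1].
- by have := fsetD11 a G; rewrite GE !inE eqxx.
Qed.

(** The last hypothesis says that the link of [x] is a cone with apex [a]: a chain through [x] stays
    a chain when [a] is added or deleted. *)
Lemma collapses_order_complex_del (le : T -> T -> Prop) A x a :
    x != a -> a \in A -> le a a -> x \in A ->
    {in A, forall y, le x y \/ le y x -> le a y \/ le y a} ->
  collapses (order_complex le [set` A]) (order_complex le [set` A `\ x]).
Proof.
move=> xa aA aa xA xya.
rewrite (_ : order_complex le [set` A `\ x] =
    [set F | order_complex le [set` A] F /\ x \notin F]%classic); last first.
  apply/seteqP; split=> F /=.
    move=> [F0 FA Fch]; split; last by apply/negP => /FA/=; rewrite !inE eqxx.
    by split=> // y /FA/=; rewrite !inE => /andP[].
  move=> [[F0 FA Fch] xF]; split=> // y yF /=; rewrite !inE (FA y yF) andbT.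
  by apply: contraNneq xF => <-.
apply: (@collapses_star_cone _ A x a) => //.
  by move=> F [_ FA _]; apply/fsubsetP => y /FA.
move=> F [F0 FA Fch] xF; split; split.
- by apply/fset0Pn; exists x; rewrite !inE xF orbT.
- by move=> y; rewrite !inE => /predU1P[->|/FA].
- have aF y : y \in F -> le a y \/ le y a.
    by move=> yF; apply: xya; [exact: FA|exact: Fch].
  move=> y z; rewrite !inE => /predU1P[->|yF] /predU1P[->|zF].
  + by left.
  + exact: aF.
  + by case: (aF y yF); [right|left].
  + exact: Fch.
- by apply/fset0Pn; exists x; rewrite !inE xF xa.
- by move=> y; rewrite !inE => /andP[_ /FA].
- by move=> y z; rewrite !inE => /andP[_ yF] /andP[_ zF]; exact: Fch.
Qed.

Lemma fset_minimal (le : T -> T -> Prop) A :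
    (forall y z t, le y z -> le z t -> le y t) ->
    (forall y z, le y z -> le z y -> y = z) ->
  A != fset0 -> exists2 x, x \in A & {in A, forall y, le y x -> y = x}.
Proof.
move=> le_trans le_anti.
have [n] := ubnP #|` A|; elim: n A => // n IH A cardA /fset0Pn[x xA].
have [[y [yA yx ynx]]|nomin] :=
    pselect (exists y, [/\ y \in A, le y x & y != x]); last first.
  exists x => // y yA yx; apply/eqP/negPn/negP => ynx; apply: nomin.
  by exists y.
pose B := [fset z in A | `[<le z x>] && (z != x)].
have BA : B `<` A.
  rewrite fproperE; apply/andP; split.
    by apply/fsubsetP => z; rewrite !inE => /andP[].
  by apply/fsubsetPn; exists x => //; rewrite !inE eqxx !andbF.
have yB : y \in B by rewrite !inE yA ynx andbT/=; apply/asboolP.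
have [||z] := IH B.
- by rewrite -ltnS (leq_trans _ cardA)// ltnS fproper_ltn_card.
- by apply/fset0Pn; exists y.
rewrite !inE/= => /and3P[zA /asboolP zx znx] zmin.
exists z => // t tA tz; apply: zmin => //; rewrite !inE tA/=.
have tx := le_trans _ _ _ tz zx; apply/andP; split; first exact/asboolP.
by apply: contraNneq znx => tE; rewrite tE in tz; apply/eqP/le_anti.
Qed.

(* A minimal point x moved by f is removed as a cone over f x; once f is the
   identity, each point other than the maximum m is removed as a cone over m. *)
Lemma collapsible_closure (le : T -> T -> Prop) A (f : T -> T) m :
    (forall y, le y y) ->
    (forall y z t, le y z -> le z t -> le y t) ->
    (forall y z, le y z -> le z y -> y = z) ->
    (forall y, le (f y) y) ->
    (forall y z, le y z -> le (f y) (f z)) ->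
    {in A, forall y, f y \in A} -> {in A, forall y, f (f y) = f y} ->
    m \in A -> f m = m -> {in A, forall y, le (f y) m} ->
  collapsible (order_complex le [set` A]).
Proof.
move=> le_refl le_trans le_anti fle fmono fA ffA mA fm fAm.
exists m; move: fA ffA mA fAm; have [n] := ubnP #|` A|.
elim: n A => // n IH A cardA fA ffA mA fAm.
(* The last condition, that only [x] itself can be sent to [x], keeps the remaining set stable under
   [f], so that the induction hypothesis applies. *)
have del x a : x \in A -> x != m -> a \in A -> x != a ->
    {in A, forall y, le x y \/ le y x -> le a y \/ le y a} ->
    {in A, forall y, f y = x -> y = x} ->
  collapses (order_complex le [set` A]) [set [fset m]]%classic.
  move=> xA xm aA xa xya fx.
  apply: collapses_trans (collapses_order_complex_del xa aA _ xA xya) _ => //.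
  apply: IH.
  - by rewrite -ltnS (leq_trans _ cardA)// ltnS (cardfsD1 x A) xA.
  - move=> y; rewrite !inE => /andP[yx yA]; rewrite fA// andbT.
    by apply: contra_neq yx; exact: fx.
  - by move=> y; rewrite !inE => /andP[_]; exact: ffA.
  - by rewrite !inE eq_sym xm.
  - by move=> y; rewrite !inE => /andP[_]; exact: fAm.
have [Fx0|] := eqVneq [fset x in A | f x != x] fset0.
  have fid : {in A, forall y, f y = y}.
    move=> y yA; apply/eqP/negPn/negP => fy.
    by have := in_fset0 y; rewrite -Fx0 !inE yA fy.
  have [[x [xA xm]]|Am] := pselect (exists x, x \in A /\ x != m).
    apply: (del x m) => // [y yA _|y yA]; last by rewrite fid.
    by right; rewrite -(fid y)//; exact: fAm.
  rewrite (_ : order_complex _ _ = [set [fset m]]%classic).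
    exact: CollapsesRefl.
  have {}Am y : y \in A -> y = m.
    by move=> yA; apply/eqP/negPn/negP => ym; apply: Am; exists y.
  apply/seteqP; split=> [F [/fset0Pn[y yF] FA _]|F ->].
    apply/fsetP => z; rewrite inE; apply/idP/eqP => [/FA/Am//|->].
    by rewrite -(Am y)// FA.
  split=> [|y|y z]; first by apply/fset0Pn; exists m; rewrite inE.
    by rewrite inE => /eqP ->.
  by rewrite !inE => /eqP -> /eqP ->; left.
move=> /(fset_minimal le_trans le_anti)[x]; rewrite !inE/= => /andP[xA fx] xmin.
apply: (del x (f x)) => //.
- by apply: contra_neq fx => ->.
- exact: fA.
- by rewrite eq_sym.
(* Points above [x] are above [f x]. A point strictly below [x] is fixed by minimality, so
   monotonicity puts it below [f x]. *)
- move=> y yA [xy|yx]; first by left; apply: le_trans xy.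
  have [->|yNx] := eqVneq y x; first by left.
  right; suff <- : f y = y by apply: fmono.
  apply/eqP; apply: contraNT yNx => fy; apply/eqP.
  by apply: xmin => //; rewrite !inE yA.
(* Idempotence makes every value of [f] a fixed point, so the moved point [x] is not a value. *)
- by move=> y yA yx; move: fx; rewrite -yx ffA// eqxx.
Qed.

End CollapsingPosets.

(** * Words, reflections and the parity cocycle *)

Section Coxeter.
Local Open Scope group_scope.
Variables (W : groupType) (S : {fset W}).
Hypothesis hWS : coxeter_system S.
Implicit Types (s t u v w x y : W) (r q : seq W).

Lemma wprod_nil : wprod [::] = 1 :> W.
Proof. by rewrite /wprod big_nil. Qed.

Lemma wprod_cons s r : wprod (s :: r) = s * wprod r.
Proof. by rewrite /wprod big_cons. Qed.

Lemma wprod_cat r q : wprod (r ++ q) = wprod r * wprod q.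
Proof. by rewrite /wprod big_cat. Qed.

Lemma word_cons s r : word S (s :: r) <-> s \in S /\ word S r.
Proof.
split=> [rS|[sS rS] t]; last by rewrite inE => /predU1P[->|/rS].
by split=> [|t tr]; apply: rS; rewrite inE ?eqxx// tr orbT.
Qed.

Lemma word_subseq r q : subseq q r -> word S r -> word S q.
Proof. by move=> /mem_subseq qr rS s /qr /rS. Qed.

Lemma generator_sqr s : s \in S -> s * s = 1.
Proof.
move=> sS; have [_ [m mm presW]] := hWS.
have [_] := mm s s sS sS; rewrite eqxx => /eqP mss.
rewrite -[s * s](_ : wprod [:: s; s] = _); last first.
  by rewrite !wprod_cons wprod_nil mulg1.
rewrite -wprod_nil; apply/presW => //.
  by apply/word_cons; split=> //; apply/word_cons.
by have := CoxeterRel m [::] [::] sS sS; rewrite mss.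
Qed.

Lemma generatorV s : s \in S -> s^-1 = s.
Proof. by move=> sS; apply: (mulgI s); rewrite mulgV generator_sqr. Qed.

Lemma generatorK s : s \in S -> cancel (mulg s) (mulg s).
Proof. by move=> /generator_sqr ss w; rewrite mulgA ss mul1g. Qed.

(** For [r = s_1 ... s_k] the i-th entry is the conjugate of [s_i] by the prefix [s_1 ... s_(i-1)];
    multiplying by it on the left deletes the i-th letter. *)
Fixpoint reflections r : seq W :=
  if r is s :: r' then s :: [seq t ^ s^-1 | t <- reflections r'] else [::].

Lemma reflections_cat r q :
  reflections (r ++ q) =
  reflections r ++ [seq t ^ (wprod r)^-1 | t <- reflections q].
Proof.
elim: r => [|s r IH] /=.
  by rewrite wprod_nil invg1 -[LHS]map_id; apply: eq_map => t; rewrite conjg1.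
rewrite IH map_cat -map_comp wprod_cons invMg; congr (_ :: _ ++ _).
by apply: eq_map => t /=; rewrite conjgM.
Qed.

Definition parity r t : bool := odd (count_mem t (reflections r)).

Lemma count_mem_conjg r t w :
  count_mem t [seq t' ^ w^-1 | t' <- r] = count_mem (t ^ w) r.
Proof.
rewrite count_map; apply: eq_count => t' /=.
by rewrite -[t in LHS](conjgK w) (inj_eq (conjg_inj _)).
Qed.

Lemma parity_cat r q t :
  parity (r ++ q) t = parity r t (+) parity q (t ^ wprod r).
Proof.
by rewrite /parity reflections_cat count_cat oddD count_mem_conjg.
Qed.

Lemma wprod_alternating s t n :
  wprod (flatten (nseq n [:: s; t])) = (s * t) ^+ n.
Proof.
elim: n => [|n IH]; first by rewrite wprod_nil.
by rewrite /= !wprod_cons IH expgS mulgA.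
Qed.

Lemma reflections_alternating s t n : s \in S -> t \in S ->
  reflections (flatten (nseq n [:: s; t])) =
  [seq (s * t) ^+ i * s | i <- iota 0 n.*2].
Proof.
move=> sS tS; elim: n => //= n ->.
rewrite expg0 mul1g -map_comp; congr [:: _, _ & _].
  by rewrite conjgE invgK (generatorV sS) expg1 mulgA.
rewrite (iotaDl 2 0) -!map_comp; apply: eq_map => i /=.
rewrite !conjgE !invgK !(generatorV sS) (generatorV tS) !mulgA.
by rewrite expgSr expgS !mulgA.
Qed.

(** The [2n] reflections are [(s * t) ^+ i * s]; as [(s * t) ^+ n = 1], the second half of the list
    repeats the first, so every count is even. *)
Lemma parity_alternating s t n x : s \in S -> t \in S ->
  (s * t) ^+ n = 1 -> parity (flatten (nseq n [:: s; t])) x = false.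
Proof.
move=> sS tS stn; rewrite /parity reflections_alternating// -addnn iotaD.
rewrite map_cat count_cat oddD add0n -[in iota n n](addn0 n) iotaDl -map_comp.
rewrite [map (_ \o _) _](_ : _ = [seq (s * t) ^+ i * s | i <- iota 0 n]).
  by rewrite addbb.
by rewrite addn0; apply: eq_map => i /=; rewrite expgD stn mul1g.
Qed.

(** Inserting a relator changes no parity: it contributes evenly, and its trivial product leaves the
    reflections of the tail unconjugated. The code 0 for infinity gives the empty relator, so the
    argument is uniform. *)
Lemma parity_wprod r q t :
  word S r -> word S q -> wprod r = wprod q -> parity r t = parity q t.
Proof.
have [_ [m _ presW]] := hWS; move=> rS qS /(presW _ _ rS qS) rq.
elim: rq t {rS qS} => // [r1 r2 s s' sS s'S t|r1 r2 r3 _ IH1 _ IH2 t];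
  last by rewrite IH1.
have alt1 : (s * s') ^+ m s s' = 1.
  rewrite -wprod_alternating -wprod_nil; apply/presW => //.
    move=> x /flattenP[l]; rewrite mem_nseq => /andP[_ /eqP ->].
    by rewrite !inE => /pred2P[] ->.
  by have := CoxeterRel m [::] [::] sS s'S; rewrite cats0.
by rewrite !parity_cat parity_alternating// wprod_alternating alt1 conjg1.
Qed.

(* The parity cocycle: for a reflection t, [inversion w t] says that t w is
   shorter than w. *)
Definition inversion w t : bool :=
  `[< exists r, [/\ word S r, w = wprod r & parity r t] >].

Lemma inversion_wprod r t : word S r -> inversion (wprod r) t = parity r t.
Proof.
move=> rS; apply/asboolP/idP => [[q [qS rq]]|rt]; last by exists r.
by rewrite (parity_wprod _ rS qS rq).
Qed.

Lemma wordP w : exists2 r, word S r & w = wprod r.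
Proof. by have [+ _] := hWS; apply. Qed.

Lemma inversionM x y t :
  inversion (x * y) t = inversion x t (+) inversion y (t ^ x).
Proof.
have [r rS ->] := wordP x; have [q qS ->] := wordP y.
rewrite -wprod_cat !inversion_wprod// ?parity_cat//.
by move=> s; rewrite mem_cat => /orP[/rS|/qS].
Qed.

Lemma inversion1 t : inversion 1 t = false.
Proof. by rewrite -wprod_nil inversion_wprod. Qed.

Lemma inversion_generator s t : s \in S -> inversion s t = (t == s).
Proof.
move=> sS; have -> : s = wprod [:: s] by rewrite wprod_cons wprod_nil mulg1.
rewrite inversion_wprod; last exact/word_cons.
by rewrite wprod_cons wprod_nil mulg1 /parity/= addn0 oddb eq_sym.
Qed.

Lemma inversionV x t : inversion x^-1 t = inversion x (t ^ x^-1).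
Proof.
have := inversionM x x^-1 (t ^ x^-1).
by rewrite mulgV inversion1 conjgKV; do 2!case: inversion.
Qed.

Lemma inversion_mulg s w : s \in S -> inversion (s * w) s = ~~ inversion w s.
Proof.
by move=> sS; rewrite inversionM inversion_generator// eqxx conjgE mulKg.
Qed.

(** * The exchange condition and the length function *)

(** An odd count is positive, so [t] occurs among the reflections of [r], and its position is that
    of the letter to delete. *)
Lemma exchange r t : word S r -> inversion (wprod r) t ->
  exists q, [/\ subseq q r, (size q).+1 = size r & t * wprod r = wprod q].
Proof.
move=> rS; rewrite inversion_wprod// /parity => /odd_gt0; rewrite -has_count.
rewrite has_pred1; elim: r t rS => // s r IH t /word_cons[sS rS] /=.
rewrite inE => /predU1P[->|/mapP[t' /(IH _ rS)[q [qr sq tq]] ->]].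
  by exists r; split; [exact: subseq_cons| |rewrite wprod_cons generatorK].
exists (s :: q); rewrite /= eqxx sq; split=> //.
by rewrite !wprod_cons -tq conjgE !mulgA mulgKV invgK.
Qed.

Lemma clengthP w : has_expression_of_size S w (clength S w) /\
  forall k, has_expression_of_size S w k -> clength S w <= k.
Proof.
apply: (xgetPex 0%N (P := [set n | has_expression_of_size S w n /\
  forall k, has_expression_of_size S w k -> n <= k]%classic)).
have exn : exists n, `[<has_expression_of_size S w n>].
  by have [r rS ->] := wordP w; exists (size r); apply/asboolP; exists r.
case: (ex_minnP exn) => n /asboolP wn nmin; exists n; split=> // k wk.
by apply: nmin; apply/asboolP.
Qed.

Lemma reduced_expressionP w : exists r, reduced_expression S w r.
Proof. by have [[r [rS -> sr]] _] := clengthP w; exists r. Qed.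

Lemma clength_le r : word S r -> clength S (wprod r) <= size r.
Proof. by move=> rS; have [_] := clengthP (wprod r); apply; exists r. Qed.

Lemma clength_generator s w : s \in S -> clength S (s * w) <= (clength S w).+1.
Proof.
move=> sS; have [r [rS -> <-]] := reduced_expressionP w.
by rewrite -wprod_cons; apply/(@clength_le (s :: r))/word_cons.
Qed.

Lemma clength_inversion s w : s \in S ->
  if inversion w s then clength S w = (clength S (s * w)).+1
  else clength S (s * w) = (clength S w).+1.
Proof.
move=> sS.
have shorter x : inversion x s -> clength S x = (clength S (s * x)).+1.
  have [r [rS xE sr]] := reduced_expressionP x.
  rewrite {1}xE => /(exchange rS)[q [qr sq]]; rewrite -xE => qE.
  apply/eqP; rewrite eqn_leq; apply/andP; split.
    by rewrite -{1}(generatorK sS x) clength_generator.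
  by rewrite -sr -sq ltnS qE (clength_le (word_subseq qr rS)).
case: ifPn => [/shorter//|ws].
(* Multiplication by [s] toggles the inversion at [s], so the first case applies to [s * w]. *)
by rewrite (shorter (s * w)) ?generatorK// inversion_mulg.
Qed.

Lemma wprod_rev r : word S r -> wprod (rev r) = (wprod r)^-1.
Proof.
elim: r => [_|s r IH /word_cons[sS rS]].
  by rewrite (_ : rev [::] = [::])// wprod_nil invg1.
rewrite rev_cons -cats1 wprod_cat wprod_cons wprod_nil mulg1 IH//.
by rewrite wprod_cons invMg (generatorV sS).
Qed.

Lemma clengthV w : clength S w^-1 = clength S w.
Proof.
have le x : clength S x^-1 <= clength S x.
  have [r [rS -> <-]] := reduced_expressionP x.
  rewrite -wprod_rev// -size_rev; apply: clength_le => s.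
  by rewrite mem_rev => /rS.
by apply/eqP; rewrite eqn_leq le -{1}(invgK w) le.
Qed.

Lemma right_descents_inversion s w :
  right_descents S w s -> s \in S /\ inversion w^-1 s.
Proof.
move=> [sS ws]; split=> //; have := clength_inversion w^-1 sS; case: ifP => //.
rewrite clengthV -clengthV invMg invgK (generatorV sS) => _ lws.
by rewrite lws ltnNge leqnSn in ws.
Qed.

(** Reduce the tail first. Prefixing [s] either lengthens it and stays reduced, or amounts by
    exchange to dropping [s] and one letter of the tail. *)
Lemma reduced_subword r : word S r ->
  exists2 q, subseq q r & reduced_expression S (wprod r) q.
Proof.
elim: r => [_|s r IH /word_cons[sS /IH[q qr [qS rq sq]]]].
  exists [::] => //; split=> //; apply/eqP.
  by rewrite eq_sym -leqn0; exact: clength_le.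
rewrite wprod_cons; have := clength_inversion (wprod r) sS; case: ifP.
  rewrite rq => /(exchange qS)[p [pq sp pE]] lq.
  exists p; first exact: subseq_trans (subseq_trans pq qr) (subseq_cons _ _).
  split=> //; first exact: word_subseq pq qS.
  by apply: succn_inj; rewrite sp -lq -rq.
move=> _ lsr; exists (s :: q); first by rewrite /= eqxx.
split; [exact/word_cons|by rewrite wprod_cons -rq|by rewrite lsr /= sq].
Qed.

(** * The Bruhat order *)

Lemma bruhat_refl w : bruhat S w w.
Proof. by move=> r [_ -> _]; exists r. Qed.

Lemma bruhat_trans u v w : bruhat S u v -> bruhat S v w -> bruhat S u w.
Proof.
move=> uv vw r rw; have [rS _ _] := rw; have [q qr vq] := vw r rw.
have [p pq pred] := reduced_subword (word_subseq qr rS).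
rewrite -vq in pred; have [p' p'p ->] := uv p pred.
by exists p' => //; apply: subseq_trans p'p (subseq_trans pq qr).
Qed.

(** A subword with as many letters as the reduced expression is the whole of it. Antisymmetry
    follows from this. *)
Lemma bruhat_clength u v :
  bruhat S u v -> clength S u <= clength S v ?= iff (u == v).
Proof.
move=> uv; have [r rv] := reduced_expressionP v.
have [q qr ->] := uv r rv; have [rS -> <-] := rv.
have qS := word_subseq qr rS; have [le_qr eq_qr] := size_subseq_leqif qr.
split; first exact: leq_trans (clength_le qS) le_qr.
apply/eqP/eqP => [lq|->]; last by have [_ <- ->] := rv.
suff : q == r by move=> /eqP ->.
by rewrite -eq_qr eqn_leq le_qr -lq clength_le.
Qed.

Lemma bruhat_anti u v : bruhat S u v -> bruhat S v u -> u = v.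
Proof.
move=> /bruhat_clength[uv /esym uvE] /bruhat_clength[vu _].
by apply/eqP; rewrite uvE eqn_leq uv.
Qed.

Lemma bruhatV u v : bruhat S u v -> bruhat S u^-1 v^-1.
Proof.
move=> uv r [rS vr sr]; have [|q qr ->] := uv (rev r).
  split; first by move=> s; rewrite mem_rev => /rS.
    by rewrite wprod_rev// -vr invgK.
  by rewrite size_rev sr clengthV.
have qS : word S q by move=> s /(mem_subseq qr); rewrite mem_rev => /rS.
by exists (rev q); rewrite ?wprod_rev// -subseq_rev revK.
Qed.

(** All elements below [v] are products of subwords of one reduced expression, and these are indexed
    by boolean masks. *)
Lemma bruhat_interval_finite v :
  exists A : {fset W}, forall u, bruhat S u v -> u \in A.
Proof.
have [r rv] := reduced_expressionP v.
exists [fset wprod (mask (tval m) r) | m in {: (size r).-tuple bool}]%fset => u.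
move=> /(_ r rv)[q /subseqP[m sm ->] ->]; apply/imfsetP => /=.
by exists (tcast sm (in_tuple m)); rewrite ?inE// val_tcast.
Qed.

(** * Shortening by a generator and the lifting property *)

(** This is the minimal representative of the coset of [w] under left multiplication by [s]. *)
Definition down s w : W := if inversion w s then s * w else w.

Lemma down_inversion s w : s \in S -> inversion (down s w) s = false.
Proof.
by move=> sS; rewrite /down; case: ifP => // ws; rewrite inversion_mulg ?ws.
Qed.

Lemma down_id s w : ~~ inversion w s -> down s w = w.
Proof. by rewrite /down => /negPf ->. Qed.

Lemma down_mulg s w : s \in S -> down s (s * w) = down s w.
Proof.
move=> sS; rewrite /down inversion_mulg//.
by case: inversion => //=; rewrite generatorK.
Qed.

Lemma down_subword s r : word S r ->
  exists2 q, subseq q r & down s (wprod r) = wprod q.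
Proof.
rewrite /down; case: ifP => [+ rS|]; last by exists r.
by move=> /(exchange rS)[q [qr _ ->]]; exists q.
Qed.

Lemma bruhat_down s w : bruhat S (down s w) w.
Proof. by move=> r [rS -> _]; have [q] := down_subword s rS; exists q. Qed.

(* The lifting property: prefixing s to a reduced expression of [down s v] gives
   one of v, so u or s u is a subword of the former, hence so is [down s u]. *)
Lemma bruhat_down_mono s u v : s \in S ->
  bruhat S u v -> bruhat S (down s u) (down s v).
Proof.
move=> sS uv; have [vs|vs] := boolP (inversion v s); last first.
  by rewrite (down_id vs); apply: bruhat_trans uv; apply: bruhat_down.
rewrite {2}/down vs => r [rS vr sr]; have := clength_inversion v sS.
rewrite vs => lv.
have [|q qsr uq] := uv (s :: r).
  by split; [exact/word_cons|rewrite wprod_cons -vr generatorK|rewrite lv -sr].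
have [q' q'r ->] : exists2 q', subseq q' r & down s u = down s (wprod q').
  rewrite uq; case: q qsr {uq} => [_|t q /=].
    by exists [::] => //; exact: sub0seq.
  (* If the subword uses the leading [s], that letter is absorbed by [down s]; otherwise the subword
     already lies in [r]. *)
  case: eqVneq => [-> qr|_]; last by exists (t :: q).
  by exists q => //; rewrite wprod_cons down_mulg.
have [p pq' ->] := down_subword s (word_subseq q'r rS).
by exists p => //; apply: subseq_trans q'r.
Qed.

(** * The automorphism and its twisted identities *)

Section TwistedIdentities.
Variable theta : W -> W.
Hypothesis htheta : coxeter_automorphism S theta.
Hypothesis hinvol : involutive theta.

Lemma thetaM : {morph theta : x y / x * y}.
Proof. by case: htheta. Qed.

Lemma theta1 : theta 1 = 1.
Proof. by apply: (mulgI (theta 1)); rewrite -thetaM !mulg1. Qed.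

Lemma thetaV x : theta x^-1 = (theta x)^-1.
Proof. by apply: (mulgI (theta x)); rewrite -thetaM !mulgV theta1. Qed.

Lemma theta_conjg x y : theta (x ^ y) = theta x ^ theta y.
Proof. by rewrite !conjgE !thetaM thetaV. Qed.

Lemma theta_inj : injective theta.
Proof. exact: can_inj hinvol. Qed.

Lemma theta_generator s : s \in S -> theta s \in S.
Proof. by case: htheta => _ _ {2}<- sS; apply: in_imfset. Qed.

Lemma inversion_theta w t : inversion (theta w) (theta t) = inversion w t.
Proof.
have [r rS ->] := wordP w.
have wprod_map q : theta (wprod q) = wprod (map theta q).
  by elim: q => [|s q IH]; rewrite ?wprod_nil ?theta1//= !wprod_cons thetaM IH.
rewrite wprod_map !inversion_wprod//; last first.
  by move=> _ /mapP[s /rS sS ->]; exact: theta_generator.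
rewrite /parity.
suff -> : reflections (map theta r) = map theta (reflections r).
  rewrite count_map; congr odd; apply: eq_count => x /=.
  by rewrite (inj_eq theta_inj).
elim: r {rS} => //= s r ->; congr cons; rewrite -!map_comp.
by apply: eq_map => x /=; rewrite theta_conjg thetaV.
Qed.

Local Notation iota := (twisted_identities theta).

Lemma twisted_identity_theta w : iota w -> theta w = w^-1.
Proof. by move=> [x _ <-]; rewrite thetaM hinvol invMg thetaV invgK. Qed.

Lemma twisted_identity_conj s w : s \in S -> iota w -> iota (theta s * w * s).
Proof.
move=> sS [x _ <-]; exists (x * s) => //.
by rewrite invMg thetaM (generatorV sS) !mulgA.
Qed.

(** Since [theta w = w^-1] and [theta] preserves the cocycle, right descents at [s] are left
    descents at [theta s]. *)
Lemma twisted_identity_inversionV s w :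
  iota w -> inversion w^-1 s = inversion w (theta s).
Proof.
by move=> /twisted_identity_theta <-; rewrite -{1}(hinvol s) inversion_theta.
Qed.

(* If w = theta(x)^-1 x then the reflection x s x^-1 is fixed by theta, so both
   factors contribute the same sign to the cocycle. *)
Lemma twisted_identity_no_descent s w :
  iota w -> theta s * w = w * s -> inversion w (theta s) = false.
Proof.
move=> [x _ <-]; rewrite thetaV => sw.
rewrite inversionM inversionV.
have fixed : theta (s ^ x^-1) = s ^ x^-1.
  rewrite theta_conjg thetaV !conjgE !invgK.
  apply: (mulgI (theta x)^-1); apply: (mulIg x).
  by rewrite !mulgA mulVg mul1g mulgKV -sw -!mulgA.
by rewrite -!thetaV -!theta_conjg inversion_theta fixed addbb.
Qed.

(** * The operator on twisted identities and its action on intervals *)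

Variable s : W.
Hypothesis sS : s \in S.

(* On twisted identities this is [star theta w s] if s is a descent of w, and w
   otherwise. *)
Definition star_down w : W := (down s (down (theta s) w)^-1)^-1.

Lemma star_down_bruhat w : bruhat S (star_down w) w.
Proof.
apply: (bruhat_trans _ (@bruhat_down (theta s) w)).
by rewrite -[X in bruhat S _ X]invgK; apply/bruhatV/bruhat_down.
Qed.

Lemma star_down_mono u v : bruhat S u v -> bruhat S (star_down u) (star_down v).
Proof.
move=> uv; apply/bruhatV/bruhat_down_mono => //.
by apply/bruhatV/bruhat_down_mono => //; exact: theta_generator.
Qed.

Lemma star_down_ascent w :
  iota w -> ~~ inversion w (theta s) -> star_down w = w.
Proof.
move=> wI ws; rewrite /star_down (down_id ws) down_id ?invgK//.
by rewrite twisted_identity_inversionV.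
Qed.

Lemma star_down_descent w :
  iota w -> inversion w (theta s) -> star_down w = theta s * w * s.
Proof.
move=> wI ws; rewrite /star_down {2}/down ws /down.
have tS := theta_generator sS.
rewrite ifT; first by rewrite invMg invgK (generatorV sS).
rewrite invMg inversionM twisted_identity_inversionV// ws (generatorV tS).
(* The two signs could cancel only if [w * s * w^-1 = theta s], and then [theta s] would not be a
   descent of [w]. *)
rewrite inversion_generator//; apply/negP => /eqP sw.
have : theta s * w = w * s by rewrite -sw conjgE invgK !mulgA mulgKV.
by move=> /(twisted_identity_no_descent wI); rewrite ws.
Qed.

Lemma star_down_twisted w : iota w -> iota (star_down w).
Proof.
move=> wI; have [ws|ws] := boolP (inversion w (theta s)).
  by rewrite star_down_descent//; exact: twisted_identity_conj.
by rewrite star_down_ascent.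
Qed.

(** The outer [down] removes the right descent [s], hence also the left descent [theta s], from a
    value that is again a twisted identity. *)
Lemma star_down_idem w : iota w -> star_down (star_down w) = star_down w.
Proof.
move=> wI; have wI' := star_down_twisted wI; apply: star_down_ascent => //.
by rewrite -twisted_identity_inversionV// invgK down_inversion.
Qed.

(** In the other branch of [star], cancellation gives [theta s = 1]; but a generator inverts itself
    while the identity inverts nothing. *)
Lemma star_commute w : star theta w s = w * s -> theta s * w * s = w.
Proof.
rewrite /star; case: eqP => // _ /mulIg; rewrite -{2}(mul1g w) => /mulIg ts.
have := inversion_generator (theta s) (theta_generator sS).
by rewrite eqxx {1}ts inversion1.
Qed.

Lemma interval_collapsible u v : iota u -> iota v -> bruhat S u v ->
    inversion v^-1 s -> theta s * u * s = u ->
  collapsible (order_complex (bruhat S) (Br_interval S theta u v)).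
Proof.
move=> uI vI uv vs us.
rewrite twisted_identity_inversionV// in vs.
have us' : theta s * u = u * s.
  by rewrite -{2}us -!mulgA generator_sqr// mulg1.
have fu : star_down u = u.
  apply: star_down_ascent => //.
  by rewrite (twisted_identity_no_descent uI us').
have below_u w : iota w -> bruhat S u w -> bruhat S u (star_down w).
  by move=> wI uw; rewrite -fu; apply: star_down_mono.
have not_u w : iota w -> u <> w -> u <> star_down w.
  move=> wI uw; have [ws|ws] := boolP (inversion w (theta s)).
    (* The map sending [x] to [theta s * x * s] is an involution fixing [u], so it sends nothing
       else to [u]. *)
    rewrite star_down_descent// => uE; apply: uw.
    rewrite -us uE !mulgA (generator_sqr (theta_generator sS)) mul1g.
    by rewrite -mulgA generator_sqr// mulg1.
  by rewrite star_down_ascent.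
have below_v w : bruhat_lt S w v -> bruhat_lt S (star_down w) v.
  move=> [wv wNv]; split; first exact: (bruhat_trans (@star_down_bruhat w) wv).
  move=> wE; apply: wNv; apply: bruhat_anti => //.
  by rewrite -wE; exact: star_down_bruhat.
have [A vA] := bruhat_interval_finite v.
pose I := [fset x in A | `[<Br_interval S theta u v x>]]%fset.
have IP x : x \in I <-> Br_interval S theta u v x.
  rewrite !inE/=; split=> [/andP[_ /asboolP//]|xuv]; apply/andP; split.
    by apply: vA; case: xuv => _ _ [].
  exact/asboolP.
rewrite (_ : Br_interval S theta u v = [set` I]%classic); last first.
  by apply/seteqP; split=> x /IP.
have vI' := star_down_twisted vI.
apply: (collapsible_closure (f := star_down) (m := star_down v)).
- exact: bruhat_refl.
- exact: bruhat_trans.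
- exact: bruhat_anti.
- exact: star_down_bruhat.
- exact: star_down_mono.
- move=> x /IP[xI [ux uNx] xv]; apply/IP; split.
  + exact: star_down_twisted.
  + by split; [exact: below_u|exact: not_u].
  + exact: below_v.
- by move=> x /IP[xI _ _]; exact: star_down_idem.
- apply/IP; split=> //; split; [exact: below_u| |exact: star_down_bruhat|].
  (* [theta s] is a left descent of [v] but not of [u], so the two differ. *)
  + apply: not_u => // uE; move: vs.
    by rewrite -uE (twisted_identity_no_descent uI us').
  (* The image of [v] lacks the left descent [theta s] that [v] has. *)
  + move=> vE; have := star_down_idem vI.
    have : inversion (star_down v) (theta s) = false.
      by rewrite -twisted_identity_inversionV// invgK down_inversion.
    by rewrite vE vs.
- exact: star_down_idem.
- by move=> x /IP[_ _ [xv _]]; exact: star_down_mono.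
Qed.

End TwistedIdentities.

End Coxeter.

Unset Implicit Arguments.

Theorem theorem4p8 (W : groupType) (S : {fset W}) (theta : W -> W) (u v : W)
    (hWS : coxeter_system S)
    (htheta : coxeter_automorphism S theta)
    (hinvol : involutive theta)
    (hu : twisted_identities theta u)
    (hv : twisted_identities theta v)
    (huv : bruhat S u v)
    (hs : exists2 s, right_descents S v s & star theta u s = (u * s)%g) :
  collapsible (order_complex (bruhat S) (Br_interval S theta u v)).
Proof.
have [s /(right_descents_inversion hWS)[sS vs] us] := hs.
apply: (interval_collapsible hWS htheta hinvol sS) => //.
exact: (star_commute hWS htheta sS).
Qed.
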